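(* There exists a constant $K>0$ with the following property. If $\psi\in C^\infty([0,1];\mathbb{R})$ satisfies $\psi(0)=0$, $|\psi(1)|\ge K$ and $\partial_r\psi(1)=0$, and the map $u=\Upsilon(\psi)$ belongs to $C^\infty(\overline{B^4(0,1)};S^4)$, then $u$ is not a biharmonic map.
   Context: $B^4(0,1)\subset\mathbb{R}^4$ is the open unit ball and $S^4=\{y\in\mathbb{R}^5: |y|=1\}$. For $\psi:[0,1]\to\mathbb{R}$ with $\psi(0)=0$, the map $\Upsilon(\psi):\overline{B^4(0,1)}\to S^4$ is defined by $\Upsilon(\psi)(x)=\left(\frac{x}{|x|}\sin\psi(|x|),\cos\psi(|x|)\right)$ for $x\neq0$ and $\Upsilon(\psi)(0)=\hat e_5=(0,0,0,0,1)$. A (extrinsic) biharmonic map $u$ into $S^4$ is a critical point of $E_2(u)=\int_{B^4(0,1)}|\Delta u|^2\,dx$ among $S^4$-valued maps with the same boundary values $D^\alpha u$, $|\alpha|\le 1$; for a smooth map $u$ this means $\Delta^2u(x)\perp T_{u(x)}S^4$ for all $x\in B^4(0,1)$, with $\Delta$ the componentwise Laplacian of the $\mathbb{R}^5$-valued map $u$. *)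

(* Defs.v *)
From HB Require Import structures.
From mathcomp Require Import all_boot all_order all_algebra.
From mathcomp Require Import all_classical all_reals all_analysis.

Set Implicit Arguments.
Unset Strict Implicit.
Unset Printing Implicit Defensive.

Import Order.TTheory GRing.Theory Num.Theory.
Import numFieldNormedType.Exports.

Local Open Scope classical_set_scope.
Local Open Scope ring_scope.

(* The library norm on 'rV[R]_n is the sup norm; it induces the same topology
   as the Euclidean norm below, so continuity and derivatives are the usual
   ones, but lengths, balls and spheres must be taken with [enorm]. *)
Definition edot (R : realType) (n : nat) (x y : 'rV[R]_n) : R :=
  \sum_(i < n) x 0 i * y 0 i.

Definition enorm (R : realType) (n : nat) (x : 'rV[R]_n) : R :=
  Num.sqrt (edot x x).

Definition unit_ball (R : realType) (n : nat) : set 'rV[R]_n :=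
  [set x | enorm x < 1].

Definition closed_unit_ball (R : realType) (n : nat) : set 'rV[R]_n :=
  [set x | enorm x <= 1].

(* The sphere S^(n-1) in R^n. *)
Definition unit_sphere (R : realType) (n : nat) : set 'rV[R]_n :=
  [set y | enorm y = 1].

(* The tangent space at p of the unit sphere, as a linear subspace of R^n. *)
Definition tangent_sphere (R : realType) (n : nat) (p : 'rV[R]_n) :
  set 'rV[R]_n := [set v | edot p v = 0].

Definition partial (R : realType) (n m : nat) (i : 'I_n)
  (f : 'rV[R]_n -> 'rV[R]_m) : 'rV[R]_n -> 'rV[R]_m :=
  fun x => 'D_(delta_mx 0 i) f x.

(* partials [:: i1; ...; ik] f = d_i1 (... (d_ik f)) *)
Definition partials (R : realType) (n m : nat) (s : seq 'I_n)
  (f : 'rV[R]_n -> 'rV[R]_m) : 'rV[R]_n -> 'rV[R]_m :=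
  foldr (@partial R n m) f s.

Definition laplacian (R : realType) (n m : nat)
  (f : 'rV[R]_n -> 'rV[R]_m) : 'rV[R]_n -> 'rV[R]_m :=
  fun x => \sum_(i < n) partial i (partial i f) x.

(* C^oo([0,1]; R): smooth in the open interval, with all derivatives extending
   continuously to [0,1], the extension of psi itself being psi.  Only the
   values of psi on [0,1] matter, here and below. *)
Definition smooth_unit_itv (R : realType) (psi : R -> R) : Prop :=
  {within `[0, 1], continuous psi} /\
  forall k : nat,
    (forall r : R, r \in `]0, 1[ -> derivable (derive1n k psi) r 1) /\
    exists g : R -> R, {within `[0, 1], continuous g} /\
      forall r : R, r \in `]0, 1[ -> g r = derive1n k psi r.

(* C^oo of the closed unit ball, with the same convention. *)
Definition smooth_closed_ball (R : realType) (n m : nat)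
  (f : 'rV[R]_n -> 'rV[R]_m) : Prop :=
  {within @closed_unit_ball R n, continuous f} /\
  forall s : seq 'I_n,
    (forall (i : 'I_n) x, unit_ball x ->
       derivable (partials s f) x (delta_mx 0 i)) /\
    exists g : 'rV[R]_n -> 'rV[R]_m,
      {within @closed_unit_ball R n, continuous g} /\
      forall x, unit_ball x -> g x = partials s f x.

Definition smooth_closed_ball_to_sphere (R : realType) (n m : nat)
  (f : 'rV[R]_n -> 'rV[R]_m) : Prop :=
  smooth_closed_ball f /\
  forall x, closed_unit_ball x -> unit_sphere (f x).

(* The one-sided derivative of psi at 1 from inside [0,1] equals l. *)
Definition left_derivative_at1 (R : realType) (psi : R -> R) (l : R) : Prop :=
  (psi r - psi 1) / (r - 1) @[r --> 1^'-] --> l.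

Definition Upsilon (R : realType) (psi : R -> R) (x : 'rV[R]_4) : 'rV[R]_5 :=
  if x == 0 then delta_mx 0 ord_max
  else row_mx ((sin (psi (enorm x)) / enorm x) *: x)
              (const_mx (cos (psi (enorm x))) : 'rV[R]_1).

(* (Extrinsic) biharmonicity of a smooth sphere-valued map u on the unit ball:
   the Euler-Lagrange equation Delta^2 u(x) _|_ T_{u(x)} S of the energy
   int |Delta u|^2 under the constraint |u| = 1. *)
Definition biharmonic_to_sphere (R : realType) (n m : nat)
  (u : 'rV[R]_n -> 'rV[R]_m) : Prop :=
  forall x, unit_ball x ->
    forall v, tangent_sphere (u x) v -> edot (laplacian (laplacian u) x) v = 0.

(* Main.v *)
(* In the variable [t = ln r] the energy of [Upsilon psi] has, up to an exact
   derivative, the autonomous Lagrangian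
   [psi''^2 + psi'^4 + (10 - 6 sin^2 psi) psi'^2 + 9 sin^2 psi], because E_2 is
   scale invariant in dimension 4.  Its Hamiltonian is conserved and tends to 0
   as [t -> -oo], so it vanishes.  Consider [A = psi'^2 - sin^2 psi], which is
   identically 0 on the stereographic solutions [psi = 2 arctan (lambda r)].
   The vanishing of the Hamiltonian gives [A'' = (8 + 4 sin^2 psi + 3 A) A]
   wherever [A' = 0] and [psi' <> 0], so [A] has no positive interior maximum.
   As [A] is 0 at the origin and [- sin^2 (psi 1) <= 0] at [r = 1], it is
   nonpositive throughout, i.e. [|psi'| <= |sin psi|], and then [psi] can never
   reach [pi] or [- pi].  Hence [K = pi] works. *)
Require Import Defs.
From mathcomp Require Import all_boot all_order all_algebra.
From mathcomp Require Import all_classical all_reals all_analysis.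
From mathcomp Require Import ring lra.

Set Implicit Arguments.
Unset Strict Implicit.
Unset Printing Implicit Defensive.

Import Order.TTheory GRing.Theory Num.Theory.
Import numFieldNormedType.Exports.
Local Open Scope classical_set_scope.
Local Open Scope ring_scope.

(** * Rules of calculus for directional derivatives *)

Section directional_derivatives.
Context {R : realType}.

(** Both sides have the same difference quotient. This carries one-variable results, such as the
    chain rule, over to directional derivatives. *)
Lemma is_derive_line (V W : normedModType R) (f : V -> W) (a v : V) (d : W) :
  is_derive a v f d <-> is_derive (0 : R) (1 : R) (fun t : R => f (t *: v + a)) d.
Proof.
have E : (fun h : R => h^-1 *: ((f \o shift a) (h *: v) - f a)) =
  (fun h : R => h^-1 *: (((fun t : R => f (t *: v + a)) \o shift 0) (h *: (1 : R))
     - f ((0 : R) *: v + a))).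
  by apply/funext => h /=; rewrite addr0 scale0r add0r [h *: 1]mulr1.
by split=> -[h1 h2]; constructor; move: h1 h2; rewrite /derivable /derive E.
Qed.

Section scalar.
Variables (V : normedModType R) (a v : V).
Implicit Types (f g : V -> R) (df dg : R).

Lemma is_derive_add f g df dg : is_derive a v f df -> is_derive a v g dg ->
  is_derive a v (fun x => f x + g x) (df + dg).
Proof. by move=> hf hg; exact: (is_deriveD hf hg). Qed.

Lemma is_derive_opp f df : is_derive a v f df ->
  is_derive a v (fun x => - f x) (- df).
Proof. by move=> hf; exact: (is_deriveN hf). Qed.

Lemma is_derive_mul f g df dg : is_derive a v f df -> is_derive a v g dg ->
  is_derive a v (fun x => f x * g x) (df * g a + f a * dg).
Proof.
move=> hf hg; apply: (is_derive_eq (is_deriveM hf hg)).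
by rewrite addrC [g a *: df]mulrC.
Qed.

Lemma is_derive_exp f df k : is_derive a v f df ->
  is_derive a v (fun x => f x ^+ k) (k%:R * f a ^+ k.-1 * df).
Proof.
move=> hf; rewrite [X in is_derive _ _ X _](_ : _ = f ^+ k).
  by apply: is_deriveX.
by apply/funext => x; rewrite fctE.
Qed.

Lemma is_derive_const (k : R) : is_derive a v (fun=> k) 0.
Proof. exact: is_derive_cst. Qed.

Lemma is_derive_chain (F : R -> R) f dF df : is_derive (f a) (1 : R) F dF ->
  is_derive a v f df -> is_derive a v (fun x => F (f x)) (dF * df).
Proof.
move=> hF /is_derive_line hf; apply/is_derive_line.
by apply: (@is_derive1_comp _ F _ 0) => //; rewrite scale0r add0r.
Qed.

Lemma is_derive_inv f df : f a != 0 -> is_derive a v f df ->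
  is_derive a v (fun x => (f x)^-1) (- (f a ^- 2) * df).
Proof.
move=> fa0 [hf <-]; constructor; first exact: derivableV.
by rewrite deriveV.
Qed.

End scalar.

Lemma is_derive_mx (V : normedModType R) m n (M : V -> 'M[R]_(m, n)) a v
  (D : 'M[R]_(m, n)) :
  (forall i j, is_derive a v (fun x => M x i j) (D i j)) -> is_derive a v M D.
Proof.
move=> hM.
have dM : derivable M a v by apply/derivable_mxP => i j; case: (hM i j).
constructor => //; rewrite derive_mx //; apply/matrixP => i j; rewrite mxE.
by case: (hM i j).
Qed.

Lemma is_derive_coord n (a v : 'rV[R]_n) (j : 'I_n) :
  is_derive a v (fun x : 'rV[R]_n => x 0 j) (v 0 j).
Proof.
apply/is_derive_line.
rewrite [X in is_derive _ _ X _](_ : _ = fun t : R => t * v 0 j + a 0 j); last first.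
  by apply/funext => t; rewrite !mxE.
eapply is_derive_eq.
  eapply is_derive_add; last exact: is_derive_const.
  by eapply is_derive_mul; [exact: is_derive_id|exact: is_derive_const].
by rewrite mulr0 addr0 addr0 mul1r.
Qed.

End directional_derivatives.

(** * Laplacian of radial maps away from the origin, where [enorm] is differentiable *)

Definition punctured_ball (R : realType) (n : nat) : set 'rV[R]_n :=
  [set x | 0 < enorm x < 1].
Arguments punctured_ball {R} n.

Section radial.
Context {R : realType}.

Lemma edot_ge0 n (x : 'rV[R]_n) : 0 <= edot x x.
Proof. by apply: sumr_ge0 => i _; rewrite -expr2 sqr_ge0. Qed.

Lemma sqr_enorm n (x : 'rV[R]_n) : enorm x ^+ 2 = edot x x.
Proof. by rewrite sqr_sqrtr // edot_ge0. Qed.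

Lemma enorm_continuous n : continuous (@enorm R n).
Proof.
have ce : continuous (fun x : 'rV[R]_n => edot x x).
  apply: (@continuous_big R^o) => [|i _ x]; first exact: add_continuous.
  have ci := @coord_continuous R 1 n 0 i x.
  exact: (continuousM ci ci).
move=> x; apply: continuous_comp; [exact: ce|exact: sqrt_continuous].
Qed.

Lemma is_derive_enorm n (x v : 'rV[R]_n) : 0 < enorm x ->
  is_derive x v (@enorm R n) (edot x v / enorm x).
Proof.
move=> x0.
have e0 : 0 < edot x x by rewrite -sqr_enorm exprn_gt0.
have h : is_derive x v (fun y : 'rV[R]_n => edot y y) (2 * edot x v).
  rewrite [X in is_derive _ _ X _](_ : _ =
      \sum_(i < n) (fun y : 'rV[R]_n => y 0 i * y 0 i)); last first.
    by apply/funext => y; rewrite fct_sumE.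
  eapply is_derive_eq.
    by apply: is_derive_sum => i; eapply is_derive_mul; exact: is_derive_coord.
  by rewrite /edot mulr_sumr; apply: eq_bigr => i _; ring.
apply: (is_derive_eq (is_derive_chain
  (f := fun y => edot y y) (is_derive1_sqrt e0) h)).
rewrite -/(enorm x); field.
by rewrite gt_eqF.
Qed.

Lemma edot_delta n (x : 'rV[R]_n) i : edot x (delta_mx 0 i) = x 0 i.
Proof.
rewrite /edot (bigD1 i) //= big1 => [|j /negPf ji]; rewrite !mxE.
  by rewrite !eqxx mulr1 addr0.
by rewrite ji andbF mulr0.
Qed.

Lemma edot_row_mx n m (x y : 'rV[R]_n) (z w : 'rV[R]_m) :
  edot (row_mx x z) (row_mx y w) = edot x y + edot z w.
Proof.
rewrite /edot big_split_ord /=; congr (_ + _); apply: eq_bigr => i _;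
  by rewrite ?row_mxEl ?row_mxEr.
Qed.

(** Off the origin [Upsilon psi] has this form, with [F r = sin (psi r) / r] and
    [G r = cos (psi r)]. The class is stable under the Laplacian, so the bilaplacian comes from
    applying one formula twice. *)
Definition radial_map n (F G : R -> R) (x : 'rV[R]_n) : 'rV[R]_(n + 1) :=
  row_mx (F (enorm x) *: x) (const_mx (G (enorm x))).

Lemma open_punctured_ball n : open (@punctured_ball R n).
Proof.
rewrite /punctured_ball (_ : [set x | _] = @enorm R n @^-1` `]0, 1[%classic).
  by apply: open_comp => // x _; exact: enorm_continuous.
by apply/seteqP; split=> x /=; rewrite in_itv.
Qed.

(** Derivatives are local. This allows iterated derivatives of formulas that are valid only on the
    punctured ball. *)
Lemma partial_eq_open n m (A : set 'rV[R]_n) (f g : 'rV[R]_n -> 'rV[R]_m) i :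
  open A -> {in A, f =1 g} -> {in A, partial i f =1 partial i g}.
Proof.
move=> oA fg x xA; apply: near_eq_derive.
near=> y; apply: fg; rewrite inE; near: y.
by apply: open_nbhs_nbhs; split=> //; rewrite inE in xA.
Unshelve. all: by end_near. Qed.

Lemma laplacian_eq_open n m (A : set 'rV[R]_n) (f g : 'rV[R]_n -> 'rV[R]_m) :
  open A -> {in A, f =1 g} -> {in A, laplacian f =1 laplacian g}.
Proof.
move=> oA fg x xA; apply: eq_bigr => i _.
exact: (partial_eq_open i oA (partial_eq_open i oA fg)).
Qed.

Lemma partial_radial n (F F1 G G1 : R -> R) (i : 'I_n) :
  (forall r : R, 0 < r < 1 -> is_derive r 1 F (F1 r)) ->
  (forall r : R, 0 < r < 1 -> is_derive r 1 G (G1 r)) ->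
  {in punctured_ball n, partial i (radial_map F G) =1 fun x =>
    row_mx (F (enorm x) *: delta_mx 0 i +
            (F1 (enorm x) * (x 0 i / enorm x)) *: x)
           (const_mx (G1 (enorm x) * (x 0 i / enorm x)))}.
Proof.
move=> hF hG x; rewrite inE => x01.
have hN := is_derive_enorm (delta_mx 0 i) (andP x01).1.
rewrite edot_delta in hN.
apply: (@derive_val _ _ _ x (delta_mx 0 i)); apply: is_derive_mx => k j.
rewrite (ord1 k) {k}; case: (split_ordP j) => {}j ->.
  rewrite [X in is_derive _ _ X _](_ : _ = fun y => F (enorm y) * y 0 j); last first.
    by apply/funext => y; rewrite row_mxEl !mxE.
  eapply is_derive_eq.
    eapply is_derive_mul; last exact: is_derive_coord.
    exact: (is_derive_chain (hF _ x01) hN).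
  by rewrite row_mxEl !mxE addrC.
rewrite [X in is_derive _ _ X _](_ : _ = fun y => G (enorm y)); last first.
  by apply/funext => y; rewrite row_mxEr !mxE.
apply: is_derive_eq (is_derive_chain (hG _ x01) hN) _.
by rewrite row_mxEr mxE.
Qed.

(** A scalar radial function has Laplacian [G'' + (n - 1) G' / r]. For the components [F(|x|) x_j]
    the cross term [2 d_j F = 2 F' x_j / r] raises the coefficient to [n + 1]. *)
Lemma laplacian_radial n (F F1 F2 G G1 G2 : R -> R) :
  (forall r : R, 0 < r < 1 -> is_derive r 1 F (F1 r)) ->
  (forall r : R, 0 < r < 1 -> is_derive r 1 F1 (F2 r)) ->
  (forall r : R, 0 < r < 1 -> is_derive r 1 G (G1 r)) ->
  (forall r : R, 0 < r < 1 -> is_derive r 1 G1 (G2 r)) ->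
  {in punctured_ball n, laplacian (radial_map F G) =1
    radial_map (fun r => F2 r + (n%:R + 1) * F1 r / r)
               (fun r => G2 r + (n%:R - 1) * G1 r / r)}.
Proof.
move=> hF hF1 hG hG1 x xA.
have := xA; rewrite inE => x01.
have r0 : enorm x != 0 by rewrite gt_eqF // (andP x01).1.
set r := enorm x in r0.
(* The factor [r^-1 - x_i^2 / r^3] is the [i]-th partial derivative of [x_i / r]. *)
have second (i : 'I_n) : partial i (partial i (radial_map F G)) x =
    row_mx ((2 * F1 r * (x 0 i / r)) *: delta_mx 0 i
      + (F2 r * (x 0 i / r) ^+ 2 + F1 r * (r^-1 - x 0 i ^+ 2 / r ^+ 3)) *: x)
     (const_mx (G2 r * (x 0 i / r) ^+ 2 + G1 r * (r^-1 - x 0 i ^+ 2 / r ^+ 3))).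
  have hN := is_derive_enorm (delta_mx 0 i) (andP x01).1.
  rewrite edot_delta in hN.
  have hq : is_derive x (delta_mx 0 i) (fun y : 'rV[R]_n => y 0 i / enorm y)
      (r^-1 - x 0 i ^+ 2 / r ^+ 3).
    eapply is_derive_eq.
      eapply is_derive_mul; first exact: is_derive_coord.
      exact: is_derive_inv hN.
    by rewrite mxE !eqxx -/r /= mulr1n; field.
  rewrite (partial_eq_open i (@open_punctured_ball n) (partial_radial i hF hG)) //.
  apply: (@derive_val _ _ _ x (delta_mx 0 i)); apply: is_derive_mx => k j.
  rewrite (ord1 k) {k}; case: (split_ordP j) => {}j ->.
    rewrite [X in is_derive _ _ X _](_ : _ = fun y => F (enorm y) *
        (delta_mx 0 i : 'rV[R]_n) 0 j +
        F1 (enorm y) * (y 0 i / enorm y) * y 0 j); last first.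
      by apply/funext => y; rewrite row_mxEl !mxE.
    eapply is_derive_eq.
      eapply is_derive_add; eapply is_derive_mul.
      - exact: (is_derive_chain (hF _ x01) hN).
      - exact: is_derive_const.
      - eapply is_derive_mul; last exact: hq.
        exact: (is_derive_chain (hF1 _ x01) hN).
      - exact: is_derive_coord.
    rewrite row_mxEl -/r !mxE; case: (_ && _); rewrite ?mulr0n ?mulr1n; field => //.
  rewrite [X in is_derive _ _ X _](_ : _ = fun y =>
        G1 (enorm y) * (y 0 i / enorm y)); last first.
    by apply/funext => y; rewrite row_mxEr !mxE.
  eapply is_derive_eq.
    eapply is_derive_mul; last exact: hq.
    exact: (is_derive_chain (hG1 _ x01) hN).
  by rewrite row_mxEr mxE -/r; field.
have sumsq : \sum_(i < n) x 0 i ^+ 2 = r ^+ 2.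
  by rewrite sqr_enorm; apply: eq_bigr => i _; rewrite expr2.
have sumc (a b : R) : \sum_(i < n) (a * (x 0 i / r) ^+ 2 +
    b * (r^-1 - x 0 i ^+ 2 / r ^+ 3)) = a + (n%:R - 1) * b / r.
  transitivity (\sum_(i < n) ((a / r ^+ 2 - b / r ^+ 3) * x 0 i ^+ 2 + b / r)).
    by apply: eq_bigr => i _; field.
  rewrite big_split /= -mulr_sumr sumsq sumr_const card_ord -[X in _ + X]mulr_natl.
  by field.
rewrite /laplacian (eq_bigr _ (fun i _ => second i)).
apply/rowP => j; rewrite summxE.
case: (split_ordP j) => {}j ->.
  rewrite row_mxEl mxE -/r.
  under eq_bigr do rewrite row_mxEl !mxE.
  (* Only the index [i = j] contributes to the cross term. *)
  rewrite big_split /= -mulr_suml sumc (bigD1 j) //= eqxx big1 => [|i /negPf ij].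
    by rewrite mulr1n; field.
  by rewrite eq_sym ij mulr0.
rewrite row_mxEr mxE -/r -sumc.
by apply: eq_bigr => i _; rewrite row_mxEr mxE.
Qed.

End radial.

(** * Differentiation with respect to [t = ln r] *)

Section logarithmic_derivative.
Context {R : realType}.
Implicit Types f g a b : R -> R.

(* With [t = ln r], [f1] is the derivative of [f] with respect to [t]. *)
Definition log_deriv f f1 := forall r : R, 0 < r < 1 -> is_derive r 1 f (f1 r / r).

Lemma log_deriv_eq f f1 g g1 : log_deriv f f1 ->
  (forall r, 0 < r < 1 -> f r = g r) -> (forall r, 0 < r < 1 -> f1 r = g1 r) ->
  log_deriv g g1.
Proof.
move=> hf fg fg1 r r01; rewrite -fg1 //; apply: near_eq_is_derive (hf _ r01).
near=> y; apply: fg.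
have : y \in `]0, 1[ by near: y; apply: near_in_itvoo; rewrite in_itv.
by rewrite in_itv.
Unshelve. all: by end_near. Qed.

Lemma log_derivW f f1 f2 : log_deriv f f1 -> f1 =1 f2 -> log_deriv f f2.
Proof. by move=> hf /funext <-. Qed.

Lemma log_deriv_cst k : log_deriv (fun=> k) (fun=> 0).
Proof. by move=> r r01; rewrite mul0r; exact: is_derive_const. Qed.

Lemma log_deriv_id : log_deriv id id.
Proof.
move=> r /andP[r0 _]; rewrite divff ?gt_eqF //; exact: is_derive_id.
Qed.

Lemma log_derivD f f1 g g1 : log_deriv f f1 -> log_deriv g g1 ->
  log_deriv (fun r => f r + g r) (fun r => f1 r + g1 r).
Proof.
move=> hf hg r r01; rewrite mulrDl; exact: is_derive_add (hf _ r01) (hg _ r01).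
Qed.

Lemma log_derivN f f1 : log_deriv f f1 -> log_deriv (fun r => - f r) (fun r => - f1 r).
Proof. move=> hf r r01; rewrite mulNr; exact: is_derive_opp (hf _ r01). Qed.

Lemma log_derivM f f1 g g1 : log_deriv f f1 -> log_deriv g g1 ->
  log_deriv (fun r => f r * g r) (fun r => f1 r * g r + f r * g1 r).
Proof.
move=> hf hg r r01; apply: is_derive_eq (is_derive_mul (hf _ r01) (hg _ r01)) _.
by ring.
Qed.

Lemma log_derivX f f1 k : log_deriv f f1 ->
  log_deriv (fun r => f r ^+ k) (fun r => k%:R * f r ^+ k.-1 * f1 r).
Proof.
move=> hf r r01; apply: is_derive_eq (is_derive_exp k (hf _ r01)) _.
by rewrite mulrA.
Qed.

Lemma log_deriv_sin f f1 : log_deriv f f1 ->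
  log_deriv (fun r => sin (f r)) (fun r => cos (f r) * f1 r).
Proof.
move=> hf r r01.
apply: is_derive_eq (is_derive_chain (is_derive_sin (f r)) (hf _ r01)) _.
by rewrite mulrA.
Qed.

Lemma log_deriv_cos f f1 : log_deriv f f1 ->
  log_deriv (fun r => cos (f r)) (fun r => - sin (f r) * f1 r).
Proof.
move=> hf r r01.
apply: is_derive_eq (is_derive_chain (is_derive_cos (f r)) (hf _ r01)) _.
by rewrite mulrA.
Qed.

Lemma log_deriv_divX f f1 k : log_deriv f f1 ->
  log_deriv (fun r => f r / r ^+ k) (fun r => (f1 r - k%:R * f r) / r ^+ k).
Proof.
move=> hf r r01; have [r0 _] := andP r01; have rn0 := lt0r_neq0 r0.
apply: is_derive_eq.
  apply: is_derive_mul (hf _ r01) _.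
  apply: is_derive_inv (is_derive_exp k (is_derive_id _ _)).
  by rewrite expf_neq0.
case: k => [|k] /=; first by rewrite !mul0r mulr0 mulr0 addr0 subr0 !expr0 mulrAC.
rewrite !exprS; field.
by rewrite rn0 expf_neq0.
Qed.

End logarithmic_derivative.

(** Differentiates by following the syntax of the expression; the raw result is then brought to the
    wanted form by [log_derivW] and [ring]. *)
Ltac log_deriv :=
  repeat first [ exact: log_deriv_cst | exact: log_deriv_id
    | apply: log_derivN | apply: log_derivD | apply: log_derivM
    | apply: log_derivX | apply: log_deriv_sin | apply: log_deriv_cos
    | eassumption ].

(** * Laplacian and bilaplacian of radial maps in the logarithmic variable *)

Section radial_log.
Context {R : realType}.

(* The powers of [r] turn the Laplacian into an operator with constant
   coefficients in [ln r]. *)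
Lemma laplacian_radial_log n k l (a a1 a2 b b1 b2 : R -> R) :
  log_deriv a a1 -> log_deriv a1 a2 -> log_deriv b b1 -> log_deriv b1 b2 ->
  {in punctured_ball n,
    laplacian (radial_map (fun r => a r / r ^+ k) (fun r => b r / r ^+ l)) =1
    radial_map
      (fun r => (a2 r + (n%:R - 2 * k%:R) * a1 r + k%:R * (k%:R - n%:R) * a r)
                / r ^+ (k + 2))
      (fun r => (b2 r + (n%:R - 2 - 2 * l%:R) * b1 r
                 + l%:R * (l%:R - n%:R + 2) * b r) / r ^+ (l + 2))}.
Proof.
move=> ha ha1 hb hb1 x xA.
have log_deriv2 (f f1 f2 : R -> R) m : log_deriv f f1 -> log_deriv f1 f2 ->
    (forall r : R, 0 < r < 1 -> is_derive r 1 (fun r => f r / r ^+ m)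
      ((f1 r - m%:R * f r) / r ^+ (m + 1))) /\
    (forall r : R, 0 < r < 1 ->
      is_derive r 1 (fun r => (f1 r - m%:R * f r) / r ^+ (m + 1))
      ((f2 r - m%:R * f1 r - (m + 1)%:R * (f1 r - m%:R * f r)) / r ^+ (m + 2))).
  move=> hf hf1; split=> r r01; have rn0 := lt0r_neq0 (andP r01).1.
    apply: is_derive_eq (log_deriv_divX m hf r01) _.
    by rewrite exprD expr1 invfM mulrA.
  have hd : log_deriv (fun r => f1 r - m%:R * f r) (fun r => f2 r - m%:R * f1 r).
    apply: log_derivW; first by log_deriv.
    by move=> y /=; ring.
  apply: is_derive_eq (log_deriv_divX (m + 1) hd r01) _.
  by rewrite -mulrA -invfM -exprSr addn2 addn1.
have [hA hA1] := log_deriv2 _ _ _ k ha ha1.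
have [hB hB1] := log_deriv2 _ _ _ l hb hb1.
rewrite (laplacian_radial hA hA1 hB hB1 xA) /radial_map.
have := xA; rewrite inE => /andP[/lt0r_neq0 r0 _].
rewrite !natrD !exprD expr1.
congr (row_mx (_ *: _) (const_mx _)); field; by rewrite ?r0 ?expf_neq0.
Qed.

(** With [D = d/dt], the two Laplacians act on [a] as [D^2 + 2D - 3] and then [D^2 - 2D - 3], whose
    product is [D^4 - 10 D^2 + 9]. On [b] they act as [D^2 + 2D] and [D^2 - 2D], with product
    [D^4 - 4 D^2]. The cancellation of odd orders makes the profile equation variational in [t] with
    a conserved energy. *)
Lemma bilaplacian_radial_log (a a1 a2 a3 a4 b b1 b2 b3 b4 : R -> R) :
  log_deriv a a1 -> log_deriv a1 a2 -> log_deriv a2 a3 -> log_deriv a3 a4 ->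
  log_deriv b b1 -> log_deriv b1 b2 -> log_deriv b2 b3 -> log_deriv b3 b4 ->
  {in punctured_ball 4,
    laplacian (laplacian (radial_map (fun r => a r / r) b)) =1
    radial_map (fun r => (a4 r - 10 * a2 r + 9 * a r) / r ^+ 5)
               (fun r => (b4 r - 4 * b2 r) / r ^+ 4)}.
Proof.
move=> ha ha1 ha2 ha3 hb hb1 hb2 hb3 x xA.
have -> : radial_map (fun r => a r / r) b =
    radial_map (n := 4) (fun r => a r / r ^+ 1) (fun r => b r / r ^+ 0).
  by apply/funext => y; rewrite /radial_map expr1 expr0 divr1.
rewrite (laplacian_eq_open (@open_punctured_ball R 4)
  (laplacian_radial_log 1 0 ha ha1 hb hb1)) //.
pose L (c0 c1 : R) (f f1 f2 : R -> R) r := f2 r + c1 * f1 r + c0 * f r.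
have hL c0 c1 (f f1 f2 f3 : R -> R) : log_deriv f f1 -> log_deriv f1 f2 ->
    log_deriv f2 f3 -> log_deriv (L c0 c1 f f1 f2) (L c0 c1 f1 f2 f3).
  move=> hf hf1 hf2; apply: log_derivW; first by rewrite /L; log_deriv.
  by move=> r /=; rewrite /L; ring.
have := laplacian_radial_log 3 2 (hL _ _ _ _ _ _ ha ha1 ha2) (hL _ _ _ _ _ _ ha1 ha2 ha3)
  (hL _ _ _ _ _ _ hb hb1 hb2) (hL _ _ _ _ _ _ hb1 hb2 hb3) xA.
move=> E; apply: etrans (E _ _ _ _) _.
by rewrite /radial_map /L; congr (row_mx (_ *: _) (const_mx _)); congr (_ / _); ring.
Qed.

End radial_log.

(** * Mean value arguments for functions continuous on [[0, 1]] and differentiable inside *)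

Section unit_interval.
Context {R : realType}.
Implicit Types f g : R -> R.

Definition continuous01 f := {within `[0, 1], continuous f}.

Lemma continuous01_sub f a b : 0 <= a -> b <= 1 -> continuous01 f ->
  {within `[a, b], continuous f}.
Proof.
move=> a0 b1; apply: continuous_subspaceW => r /=; rewrite !in_itv /=.
by move=> /andP[ar rb]; rewrite (le_trans a0 ar) (le_trans rb b1).
Qed.

Lemma continuous01_comp f g : continuous g -> continuous01 f ->
  continuous01 (fun r => g (f r)).
Proof. by move=> cg cf r; apply: continuous_comp; [exact: cf|exact: cg]. Qed.

Lemma continuous01_cst k : continuous01 (fun=> k).
Proof. by move=> r; exact: cst_continuous. Qed.

Lemma continuous01_id : continuous01 (fun r : R => r).
Proof. by apply: continuous_subspaceT => r; exact: cvg_id. Qed.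

Lemma continuous01D f g : continuous01 f -> continuous01 g ->
  continuous01 (fun r => f r + g r).
Proof. by move=> cf cg r; apply: continuousD; [exact: cf|exact: cg]. Qed.

Lemma continuous01N f : continuous01 f -> continuous01 (fun r => - f r).
Proof. by move=> cf r; apply: continuousN; exact: cf. Qed.

Lemma continuous01M f g : continuous01 f -> continuous01 g ->
  continuous01 (fun r => f r * g r).
Proof. by move=> cf cg r; apply: continuousM; [exact: cf|exact: cg]. Qed.

Lemma continuous01X f k : continuous01 f -> continuous01 (fun r => f r ^+ k).
Proof.
move=> cf; apply: (@continuous01_comp f (fun y => y ^+ k)) => //.
exact: exprn_continuous.
Qed.

Lemma MVT01 f f1 a b : 0 <= a -> a < b -> b <= 1 -> continuous01 f ->
  (forall r : R, 0 < r < 1 -> is_derive r 1 f (f1 r)) ->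
  exists2 c, a < c < b & f b - f a = f1 c * (b - a).
Proof.
move=> a0 ab b1 cf hf.
have h r : r \in `]a, b[ -> is_derive r 1 f (f1 r).
  rewrite in_itv /= => /andP[ar rb]; apply: hf.
  by rewrite (le_lt_trans a0 ar) (lt_le_trans rb b1).
have [c cab E] := MVT ab h (continuous01_sub a0 b1 cf).
by exists c => //; rewrite in_itv in cab.
Qed.

Lemma log_deriv0_cst f : continuous01 f -> log_deriv f (fun=> 0) ->
  forall r, 0 <= r <= 1 -> f r = f 0.
Proof.
move=> cf hf r /andP[]; rewrite le_eqVlt => /predU1P[<- //|r0] r1.
have [c _] := MVT01 (lexx 0) r0 r1 cf hf.
by rewrite mul0r mul0r => /eqP; rewrite subr_eq0 => /eqP.
Qed.

(** By the mean value theorem the quotient on [[r, 1]] is a value [f1 c] with [r < c < 1], which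
    tends to [f1 1]. Thus the boundary condition on [psi] fixes the value at 1 of the continuous
    extension of its derivative. *)
Lemma left_derivative_eq f f1 l : continuous01 f -> continuous01 f1 ->
  (forall r : R, 0 < r < 1 -> is_derive r 1 f (f1 r)) ->
  left_derivative_at1 f l -> f1 1 = l.
Proof.
move=> cf cf1 hf hl.
suff h : (f r - f 1) / (r - 1) @[r --> 1^'-] --> f1 1.
  exact: (cvg_unique _ h hl).
have [_ _ /cvgrPdist_lt h] := (continuous_within_itvP f1 ltr01).1 cf1.
apply/cvgrPdist_lt => e e0.
have [d /= d0 hd] := h _ e0.
near=> r.
have r1 : r < 1 by near: r; exact: nbhs_left_lt.
have r0 : 0 < r by near: r; exact: nbhs_left_gt.
have dr : 1 - d < r by near: r; apply: nbhs_left_gt; rewrite ltrBlDr ltrDl.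
have [c /andP[rc c1]] := MVT01 (ltW r0) r1 (lexx 1) cf hf.
rewrite -(opprB (f 1)) -(opprB 1 r) => ->.
rewrite invrN mulrNN mulfK ?subr_eq0 ?gt_eqF //.
apply: hd => //=; rewrite gtr0_norm ?subr_gt0 //; lra.
Unshelve. all: by end_near. Qed.

(** If [d > 0], then [f1] is positive just to the right of its zero [c], so [f] exceeds [f c] there.
    At a critical point the sign of [d] is that of the second derivative of [f], although [f1] is
    the logarithmic derivative. *)
Lemma second_derivative_test f f1 c d : continuous01 f -> log_deriv f f1 ->
  0 < c < 1 -> f1 c = 0 -> is_derive c 1 f1 d ->
  (forall r, 0 < r < 1 -> f r <= f c) -> d <= 0.
Proof.
move=> cf hf /andP[c0 c1] f1c hd fmax; rewrite leNgt; apply/negP => d0.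
have [cvgq dE] := hd.
have : h^-1 *: ((f1 \o shift c) (h *: 1) - f1 c) @[h --> 0^'] --> d.
  by rewrite -dE; exact: cvgq.
move=> /cvgr_gt /(_ _ d0) [e /= e0 he].
(* The point [b] lies to the right of [c], within [e] of it and below 1. *)
pose b := Num.min (c + e / 2) ((c + 1) / 2).
have cb : c < b by rewrite lt_min; apply/andP; split; lra.
have b1 : b <= 1 by rewrite ge_min; apply/orP; right; lra.
have be : b <= c + e / 2 by rewrite ge_min lexx.
have b1' : b < 1 by rewrite gt_min; apply/orP; right; lra.
have [x /andP[cx xb] E] := MVT01 (ltW c0) cb b1 cf hf.
have x0 : 0 < x by exact: lt_trans cx.
have xc0 : 0 < x - c by rewrite subr_gt0.
have : 0 < f1 x.
  have := he (x - c); rewrite /= sub0r normrN (gtr0_norm xc0) (gt_eqF xc0).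
  move=> /(_ _ isT); rewrite f1c subr0 [(x - c) *: 1]mulr1 subrK.
  rewrite pmulr_rgt0 ?invr_gt0 //; apply; lra.
move=> f1x.
have : f b <= f c by apply: fmax; rewrite (lt_trans c0 cb).
rewrite leNgt => /negP; apply; rewrite -subr_gt0 E.
by rewrite mulr_gt0 ?subr_gt0 // divr_gt0.
Qed.

End unit_interval.

Ltac continuous01 :=
  repeat lazymatch goal with
  | |- continuous01 (fun _ => ?k) => exact (@continuous01_cst _ k)
  | |- continuous01 (fun r => r) => exact continuous01_id
  | |- continuous01 (fun r => - @?f r) => apply (@continuous01N _ f)
  | |- continuous01 (fun r => @?f r + @?g r) => apply (@continuous01D _ f g)
  | |- continuous01 (fun r => @?f r * @?g r) => apply (@continuous01M _ f g)
  | |- continuous01 (fun r => @?f r ^+ ?k) => apply (@continuous01X _ f k)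
  | |- continuous01 (fun r => sin (@?f r)) =>
      apply (@continuous01_comp _ f sin (@continuous_sin _))
  | |- continuous01 (fun r => cos (@?f r)) =>
      apply (@continuous01_comp _ f cos (@continuous_cos _))
  | _ => assumption
  end.

(** * The ordinary differential equation of the profile, its energy, and the bound on [psi] *)

Section biharmonic_profile.
Context {R : realType}.
Variables psi P Q S W : R -> R.
Hypothesis psi_P : log_deriv psi P.
Hypothesis P_Q : log_deriv P Q.
Hypothesis Q_S : log_deriv Q S.
Hypothesis S_W : log_deriv S W.

(* The Euler-Lagrange equation of the Lagrangian
   [psi''^2 + psi'^4 + (10 - 6 sin^2 psi) psi'^2 + 9 sin^2 psi] in [t = ln r],
   where [P = psi'], [Q = psi''], [S = psi'''] and [W = psi'''']. *)
Definition profile_equation := forall r, 0 < r < 1 ->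
  W r = (6 * P r ^+ 2 + 10 - 6 * sin (psi r) ^+ 2) * Q r
        - 6 * sin (psi r) * cos (psi r) * P r ^+ 2
        - 9 * sin (psi r) * cos (psi r).

(** The orthogonality condition is tested at one point of each sphere [|x| = r], against the tangent
    vector obtained by differentiating [Upsilon psi] with respect to the value of [psi]. *)
Lemma biharmonic_profile_equation :
  biharmonic_to_sphere (Upsilon psi) -> profile_equation.
Proof.
move=> hb r r01; have [r0 r1] := andP r01; have rn0 := lt0r_neq0 r0.
(* Successive derivatives in [t] of [sin psi] and [cos psi]. *)
pose a := fun r => sin (psi r).
pose a1 := fun r => cos (psi r) * P r.
pose a2 := fun r => cos (psi r) * Q r - sin (psi r) * P r ^+ 2.
pose a3 := fun r => cos (psi r) * S r - 3 * sin (psi r) * P r * Q r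
                    - cos (psi r) * P r ^+ 3.
pose a4 := fun r => cos (psi r) * W r - 4 * sin (psi r) * P r * S r
  - 3 * sin (psi r) * Q r ^+ 2 - 6 * cos (psi r) * P r ^+ 2 * Q r
  + sin (psi r) * P r ^+ 4.
pose b := fun r => cos (psi r).
pose b1 := fun r => - sin (psi r) * P r.
pose b2 := fun r => - sin (psi r) * Q r - cos (psi r) * P r ^+ 2.
pose b3 := fun r => - sin (psi r) * S r - 3 * cos (psi r) * P r * Q r
                    + sin (psi r) * P r ^+ 3.
pose b4 := fun r => - sin (psi r) * W r - 4 * cos (psi r) * P r * S r
  - 3 * cos (psi r) * Q r ^+ 2 + 6 * sin (psi r) * P r ^+ 2 * Q r
  + cos (psi r) * P r ^+ 4.
have [ha ha1 ha2 ha3] : [/\ log_deriv a a1, log_deriv a1 a2, log_deriv a2 a3 &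
    log_deriv a3 a4].
  by split; (apply: log_derivW; first log_deriv);
    move=> y /=; rewrite /a1 /a2 /a3 /a4; ring.
have [hb0 hb1 hb2 hb3] : [/\ log_deriv b b1, log_deriv b1 b2, log_deriv b2 b3 &
    log_deriv b3 b4].
  by split; (apply: log_derivW; first log_deriv);
    move=> y /=; rewrite /a1 /b1 /b2 /b3 /b4; ring.
have upsE : {in punctured_ball 4,
    Upsilon psi =1 radial_map (n := 4) (fun r => a r / r) b}.
  move=> y; rewrite inE => /andP[y0 _]; rewrite /Upsilon ifN //.
  apply: contraTneq y0 => ->; rewrite /enorm /edot big1 ?sqrtr0 ?ltxx // => i _.
  by rewrite mxE mul0r.
pose e0 : 'rV[R]_4 := delta_mx 0 0.
pose x := r *: e0.
have e01 : edot e0 e0 = 1 by rewrite edot_delta mxE.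
have edotZ (k m : R) : edot (k *: e0) (m *: e0) = k * m.
  rewrite -[RHS]mulr1 -e01 /edot mulr_sumr; apply: eq_bigr => i _.
  by rewrite !mxE; ring.
have edot_const (k m : R) : edot (const_mx k : 'rV[R]_1) (const_mx m) = k * m.
  by rewrite /edot big_ord1 !mxE.
have xr : enorm x = r by rewrite /enorm edotZ -expr2 sqrtr_sqr gtr0_norm.
have xA : x \in punctured_ball 4 by rewrite inE /punctured_ball /= xr.
pose v : 'rV[R]_5 := row_mx (cos (psi r) *: e0) (const_mx (- sin (psi r)) : 'rV[R]_1).
have tv : tangent_sphere (Upsilon psi x) v.
  rewrite /tangent_sphere /= upsE // /v /radial_map xr scalerA.
  by rewrite (edot_row_mx (n := 4) (m := 1)) edotZ edot_const /a /b; field.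
have := hb x; rewrite /unit_ball /= xr => /(_ r1 _ tv).
have lapE := laplacian_eq_open (@open_punctured_ball R 4) upsE.
have bilapE := laplacian_eq_open (@open_punctured_ball R 4) lapE.
have radE := bilaplacian_radial_log ha ha1 ha2 ha3 hb0 hb1 hb2 hb3.
rewrite (etrans (bilapE x xA) (radE x xA)).
rewrite /v /radial_map xr scalerA (edot_row_mx (n := 4) (m := 1)) edotZ edot_const.
rewrite /a4 /a2 /a /b4 /b2 => E.
(* In the tangential component the terms in [P S], [Q^2] and [P^4] cancel; [cos^2 + sin^2 = 1] does
   the rest. *)
have {}E : (W r - ((6 * P r ^+ 2 + 10 - 6 * sin (psi r) ^+ 2) * Q r
        - 6 * sin (psi r) * cos (psi r) * P r ^+ 2
        - 9 * sin (psi r) * cos (psi r))) / r ^+ 4 = 0.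
  rewrite -[RHS]E.
  have sc := cos2Dsin2 (psi r).
  set s := sin (psi r) in sc *; set c := cos (psi r) in sc *.
  transitivity (((c ^+ 2 + s ^+ 2) * (W r - 6 * P r ^+ 2 * Q r - 10 * Q r)
    + 6 * s ^+ 2 * Q r + 6 * s * c * P r ^+ 2 + 9 * s * c) / r ^+ 4); last by field.
  by rewrite sc; congr (_ / _); ring.
move/eqP: E; rewrite mulf_eq0 invr_eq0 expf_eq0 /= (negPf rn0) orbF subr_eq0.
by move/eqP.
Qed.

Hypothesis psi_cont : continuous01 psi.
Hypothesis P_cont : continuous01 P.
Hypothesis Q_cont : continuous01 Q.
Hypothesis S_cont : continuous01 S.
Hypothesis psi0 : psi 0 = 0.
Hypothesis P0 : P 0 = 0.
Hypothesis Q0 : Q 0 = 0.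
Hypothesis profileE : profile_equation.

(** The Hamiltonian [H] has derivative [2 P] times the defect of the profile equation, so it is
    constant. It is 0 at [r = 0] because each of its terms has a factor [P], [Q] or [sin psi]. *)
Lemma energy_zero r : 0 <= r <= 1 ->
  2 * P r * S r = Q r ^+ 2 + 3 * P r ^+ 4
    + (10 - 6 * sin (psi r) ^+ 2) * P r ^+ 2 - 9 * sin (psi r) ^+ 2.
Proof.
move=> r01.
pose H r := Q r ^+ 2 - 2 * P r * S r + 3 * P r ^+ 4
    + (10 - 6 * sin (psi r) ^+ 2) * P r ^+ 2 - 9 * sin (psi r) ^+ 2.
have cH : continuous01 H by rewrite /H; continuous01.
have dH : log_deriv H (fun=> 0).
  pose H1 r := 2 * P r * ((6 * P r ^+ 2 + 10 - 6 * sin (psi r) ^+ 2) * Q r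
        - 6 * sin (psi r) * cos (psi r) * P r ^+ 2
        - 9 * sin (psi r) * cos (psi r) - W r).
  apply: (@log_deriv_eq _ H H1) => //.
    by apply: log_derivW; [rewrite /H; log_deriv|move=> y /=; rewrite /H1; ring].
  by move=> y y01; rewrite /H1 profileE // subrr mulr0.
have := log_deriv0_cst cH dH r01.
rewrite /H psi0 P0 Q0 sin0 => E.
lra.
Qed.

Hypothesis P1 : P 1 = 0.

(** A maximum principle for [A]: at a positive maximum the second derivative would be both
    nonpositive and positive. *)
Lemma sqr_P_le_sin r : 0 <= r <= 1 -> P r ^+ 2 <= sin (psi r) ^+ 2.
Proof.
pose A r := P r ^+ 2 - sin (psi r) ^+ 2.
have cA : continuous01 A by rewrite /A; continuous01.
have [c c01 Amax] := EVT_max ler01 cA.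
suff Ac : A c <= 0.
  by move=> r01; rewrite -subr_le0; apply: le_trans Ac; apply: Amax; rewrite in_itv.
rewrite leNgt; apply/negP => Ac.
(* A positive maximum is interior, since [A 0 = 0] and [A 1 = - sin^2 (psi 1)]. *)
have c0 : 0 < c < 1.
  move: c01; rewrite in_itv /= => /andP[].
  rewrite le_eqVlt => /predU1P[E|->].
    by move: Ac; rewrite /A -E P0 psi0 sin0 !expr0n /= subrr ltxx.
  rewrite le_eqVlt => /predU1P[E|->//].
  by move: Ac; rewrite /A E P1 expr0n /= sub0r oppr_gt0 ltNge sqr_ge0.
pose A1 r := 2 * P r * (Q r - sin (psi r) * cos (psi r)).
pose A2 r := 2 * Q r * (Q r - sin (psi r) * cos (psi r))
  + 2 * P r * (S r - P r * (1 - 2 * sin (psi r) ^+ 2)).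
have dA : log_deriv A A1.
  by apply: log_derivW; [rewrite /A; log_deriv|move=> y /=; rewrite /A1; ring].
have dA1 : log_deriv A1 A2.
  apply: log_derivW; [rewrite /A1; log_deriv|move=> y /=; rewrite /A2].
  have sc := cos2Dsin2 (psi y).
  have -> : 1 - 2 * sin (psi y) ^+ 2 = cos (psi y) ^+ 2 - sin (psi y) ^+ 2.
    by lra.
  by ring.
have Amax' t : 0 < t < 1 -> A t <= A c.
  by move=> /andP[/ltW t0 /ltW t1]; apply: Amax; rewrite in_itv /= t0 t1.
have [cgt0 clt1] := andP c0.
have A1c : A1 c = 0.
  have : is_derive c 1 A 0.
    apply: (@derive1_at_max _ A 0 1) => [|t||t]; rewrite ?ler01 ?in_itv //.
      by move=> t01; case: (dA _ t01).
    exact: Amax'.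
  move=> [_ /esym]; case: (dA _ c0) => _ -> /esym/eqP.
  by rewrite mulf_eq0 invr_eq0 (gt_eqF cgt0) orbF => /eqP.
have : A2 c / c <= 0.
  exact: (second_derivative_test cA dA c0 A1c (dA1 _ c0) Amax').
rewrite leNgt => /negP; apply; apply: divr_gt0 => //.
have := energy_zero (r := c); rewrite (ltW cgt0) (ltW clt1) => /(_ isT) E.
(* From [A c > 0] follows [P c <> 0], so [A1 c = 0] forces [Q = sin psi cos psi] at [c]. *)
have P2 : 0 < P c ^+ 2.
  by move: Ac; rewrite /A subr_gt0; apply: le_lt_trans; exact: sqr_ge0.
have Pc : P c != 0 by rewrite -sqrf_eq0 gt_eqF.
move/eqP: A1c; rewrite /A1 mulf_eq0 mulf_eq0 pnatr_eq0 (negPf Pc) /= subr_eq0.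
move=> /eqP Qc.
have sc := cos2Dsin2 (psi c).
(* The vanishing energy eliminates [S], the only third-order term. *)
have -> : A2 c = (8 + 4 * sin (psi c) ^+ 2 + 3 * A c) * A c.
  transitivity (2 * P c * S c - 2 * P c ^+ 2 * (1 - 2 * sin (psi c) ^+ 2)).
    by rewrite /A2 Qc; ring.
  have c2 : cos (psi c) ^+ 2 = 1 - sin (psi c) ^+ 2 by rewrite -sc addrK.
  by rewrite E Qc exprMn c2 /A; ring.
rewrite mulr_gt0 //; have := sqr_ge0 (sin (psi c)); lra.
Qed.

(* [r^2 (1 + cos psi)] is nondecreasing. *)
Lemma cos_profile_neqN1 r : 0 <= r <= 1 -> cos (psi r) != -1.
Proof.
move=> /andP[r0 r1]; apply/negP => /eqP cr.
have c0 : cos (psi 0) = 1 by rewrite psi0 cos0.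
have cc : continuous01 (fun r => cos (psi r)) by continuous01.
(* If [cos psi] reached -1 at [r], it would vanish at some [c] in [(0, r)]. Then [M c = c^2 > 0]
   while [M r = 0], against the monotonicity of [M]. *)
have [|c] := IVT (v := 0) r0 (continuous01_sub (lexx 0) r1 cc).
  by rewrite cr c0 min_r ?max_l; lra.
rewrite in_itv /= => /andP[]; rewrite le_eqVlt => /predU1P[<-|cgt0].
  by rewrite c0 => _ /eqP; rewrite oner_eq0.
rewrite le_eqVlt => /predU1P[->|cltr cosc].
  by rewrite cr => /eqP; rewrite oppr_eq0 oner_eq0.
pose M r := r ^+ 2 * (1 + cos (psi r)).
pose M1 r := r ^+ 2 * (2 * (1 + cos (psi r)) - sin (psi r) * P r).
have cM : continuous01 M by rewrite /M; continuous01.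
have dM : log_deriv M M1.
  by apply: log_derivW; [rewrite /M; log_deriv|move=> y /=; rewrite /M1; ring].
have [x /andP[cx xr]] := MVT01 (ltW cgt0) cltr r1 cM dM.
have x0 : 0 < x by exact: lt_trans cx.
have M1x : 0 <= M1 x.
  (* Here [sin psi P <= (sin^2 psi + P^2) / 2 <= sin^2 psi], and [2 (1 + cos psi) - sin^2 psi = (1 +
     cos psi)^2]. *)
  rewrite mulr_ge0 ?sqr_ge0 //.
  have := sqr_P_le_sin (r := x); rewrite (ltW x0) (ltW (lt_le_trans xr r1)) => /(_ isT).
  have := cos2Dsin2 (psi x).
  have := sqr_ge0 (sin (psi x) - P x).
  have := sqr_ge0 (1 + cos (psi x)).
  nra.
rewrite /M cr cosc addr0 mulr1 subrr mulr0 sub0r => E.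
have : 0 <= - c ^+ 2.
  by rewrite E; apply: mulr_ge0; rewrite ?subr_ge0 ?(ltW cltr) // divr_ge0 // ltW.
by rewrite oppr_ge0 leNgt exprn_gt0.
Qed.

(** Otherwise [psi], starting from 0, would take the value [pi] or [- pi], where the cosine is
    -1. *)
Lemma profile_lt_pi : `|psi 1| < pi.
Proof.
rewrite ltNge; apply/negP => psi1.
have [v cv hv] : exists2 v, cos v = -1 &
    Num.min (psi 0) (psi 1) <= v <= Num.max (psi 0) (psi 1).
  have pi0 := pi_ge0 R.
  move: psi1; have [p|n] := ger0P (psi 1) => psi1.
    by exists pi; rewrite ?cospi // psi0 min_l // max_r // pi0.
  exists (- pi); first by rewrite cosN cospi.
  by rewrite psi0 (min_r (ltW n)) (max_l (ltW n)) oppr_le0 pi0 andbT lerNr.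
have [c] := IVT ler01 psi_cont hv.
by rewrite in_itv => /cos_profile_neqN1 /eqP + E; rewrite E cv.
Qed.

End biharmonic_profile.

(** * Application to a smooth [psi], with [K = pi] *)

Theorem theorem1p4 (R : realType) :
  exists K : R, 0 < K /\
    forall psi : R -> R,
      smooth_unit_itv psi ->
      psi 0 = 0 ->
      K <= `|psi 1| ->
      left_derivative_at1 psi 0 ->
      smooth_closed_ball_to_sphere (Upsilon psi) ->
      ~ biharmonic_to_sphere (Upsilon psi).
Proof.
exists pi; split=> [|psi [cpsi spsi] psi0 psi1 dpsi1 _ hb]; first exact: pi_gt0.
have dpsi k (r : R) : 0 < r < 1 ->
    is_derive r 1 (derive1n k psi) (derive1n k.+1 psi r).
  move=> r01; have [+ _] := spsi k; move=> /(_ r); rewrite in_itv => /(_ r01).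
  by move=> /derivableP; rewrite -derive1E.
have ldpsi k : log_deriv (derive1n k psi) (fun r => r * derive1n k.+1 psi r).
  move=> r r01; rewrite /= mulrAC divff ?mul1r ?(gt_eqF (andP r01).1) //; exact: dpsi.
(* The extensions [g1], [g2], [g3] make [P], [Q], [S] continuous up to the endpoints. The fourth
   derivative enters only in the open interval and is taken as it is. *)
have [_ [g1 [cg1 g1E]]] := spsi 1%N.
have [_ [g2 [cg2 g2E]]] := spsi 2%N.
have [_ [g3 [cg3 g3E]]] := spsi 3%N.
have {}g1E r : 0 < r < 1 -> derive1n 1 psi r = g1 r by move=> r01; rewrite g1E ?in_itv.
have {}g2E r : 0 < r < 1 -> derive1n 2 psi r = g2 r by move=> r01; rewrite g2E ?in_itv.
have {}g3E r : 0 < r < 1 -> derive1n 3 psi r = g3 r by move=> r01; rewrite g3E ?in_itv.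
pose g4 := derive1n 4 psi.
(* The iterates of [r d/dr] on [psi], with Stirling numbers of the second kind as coefficients. The
   factors [r] give [P 0 = Q 0 = 0]. *)
pose P r := r * g1 r.
pose Q r := r * g1 r + r ^+ 2 * g2 r.
pose S r := r * g1 r + 3 * r ^+ 2 * g2 r + r ^+ 3 * g3 r.
pose W r := r * g1 r + 7 * r ^+ 2 * g2 r + 6 * r ^+ 3 * g3 r
  + r ^+ 4 * g4 r.
have ld1 : log_deriv g1 (fun r => r * g2 r).
  by apply: (log_deriv_eq (ldpsi 1%N)) => // r r01; rewrite g2E.
have ld2 : log_deriv g2 (fun r => r * g3 r).
  by apply: (log_deriv_eq (ldpsi 2%N)) => // r r01; rewrite g3E.
have ld3 : log_deriv g3 (fun r => r * g4 r).
  exact: (log_deriv_eq (ldpsi 3%N)).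
have psi_P : log_deriv psi P.
  by apply: (log_deriv_eq (ldpsi 0%N)) => // r r01; rewrite g1E.
have P_Q : log_deriv P Q.
  by apply: log_derivW; [rewrite /P; log_deriv|move=> r /=; rewrite /Q; ring].
have Q_S : log_deriv Q S.
  by apply: log_derivW; [rewrite /Q; log_deriv|move=> r /=; rewrite /S; ring].
have S_W : log_deriv S W.
  by apply: log_derivW; [rewrite /S; log_deriv|move=> r /=; rewrite /W; ring].
(* The condition at [r = 1] becomes [P 1 = 0]. *)
have g11 : g1 1 = 0.
  apply: (left_derivative_eq cpsi cg1 _ dpsi1) => r r01; rewrite -g1E //.
  exact: (dpsi 0%N).
have := biharmonic_profile_equation psi_P P_Q Q_S S_W hb.
move=> /(profile_lt_pi psi_P P_Q Q_S S_W cpsi) lt_pi.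
suff : `|psi 1| < pi by rewrite ltNge psi1.
have cP : continuous01 P by rewrite /P; continuous01.
have cQ : continuous01 Q by rewrite /Q; continuous01.
have cS : continuous01 S by rewrite /S; continuous01.
by apply: lt_pi => //; rewrite /P /Q ?g11 ?expr0n ?mul0r ?mulr0 ?addr0.
Qed.
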